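(* Let $M$ be a simple matroid of rank $\ell$ on $[n]$ and let $I=I(M)\subset E$ be its Orlik–Solomon ideal. For every $p$ with $1\le p\le\ell$, the set $Z_p=\{z(T)\mid T\in\mathbf{nbc}_p\}$ forms a basis of the $R$-module $(I^0)_{n-p}$, the degree $n-p$ component of the annihilator ideal $I^0$.
   Context: $R$ is an arbitrary nonzero commutative ring with $1$. $M$ is a simple matroid (no loops, no nontrivial parallel classes) on $[n]=\{1,\dots,n\}$ of rank $\ell$. $E$ is the exterior algebra over $R$ on the free $R$-module with basis $e_1,\dots,e_n$, with the standard grading $E_p=\Lambda^p$. For $S=\{i_1<\dots<i_p\}\subset[n]$ put $e_S=e_{i_1}\cdots e_{i_p}$ ($e_\emptyset=1$). $\partial:E\to E$ is the $R$-linear map of degree $-1$ with $\partial e_i=1$ for all $i$ and $\partial(ab)=(\partial a)b+(-1)^{\deg a}a\,\partial b$ for homogeneous $a$ and all $b$. The Orlik–Solomon ideal $I=I(M)$ is the ideal of $E$ generated by $\partial e_S$ for all dependent sets $S$ of $M$. The annihilator is the graded ideal $I^0=\{a\in E\mid ab=0\text{ for every }b\in I\}$. A broken circuit is a circuit of $M$ with its smallest element deleted. A subset of $[n]$ is $\mathbf{nbc}$ if it contains no broken circuit; $\mathbf{nbc}_p$ is the set of $\mathbf{nbc}$-sets of cardinality $p$. $cl$ is the closure operator of $M$. Definition of $z(T)$ for $T=\{i_1<\dots<i_p\}\in\mathbf{nbc}_p$, $1\le p\le \ell$: put $X_0=\emptyset$, $X_q=cl(\{i_{p-q+1},\dots,i_p\})$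 and $S_q=X_q\setminus X_{q-1}$ for $1\le q\le p$. Then $S_1,\dots,S_p$ partition $X_p$ and $$z(T)=\mathrm{sign}(\sigma)\,\partial(e_{S_1})\partial(e_{S_2})\cdots\partial(e_{S_p})\,e_{[n]\setminus X_p},$$ where $\sigma$ is the permutation of $[n]$ listing the elements of $S_1$, then $S_2$, ..., then $S_p$, then $[n]\setminus X_p$, each block in increasing order. *)

(* Defs.v *)
From HB Require Import structures.
From mathcomp Require Import all_boot all_order all_fingroup all_algebra.
From mathcomp Require Import ring.

Set Implicit Arguments.
Unset Strict Implicit.
Unset Printing Implicit Defensive.

Import GRing.Theory.
Local Open Scope ring_scope.

(* The exterior algebra on the free module with basis e_i, i : 'I_n: an element
   is given by its coordinates in the basis (e_S), S : {set 'I_n}; see e_gen_sqr,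
   e_gen_anticomm and e_setE below for the defining relations. *)
Definition exterior (R : comNzRingType) (n : nat) := {ffun {set 'I_n} -> R^o}.

HB.instance Definition _ (R : comNzRingType) n :=
  GRing.Lmodule.copy (exterior R n) {ffun {set 'I_n} -> R^o}.

(* For disjoint A and B, (-1) ^+ inversions A B is the sign of the permutation
   listing A then B, each increasingly, so that
   e_A * e_B = (-1) ^+ inversions A B *: e_(A :|: B). *)
Definition inversions n (A B : {set 'I_n}) : nat :=
  (\sum_(i in A) \sum_(j in B) (j < i))%N.

Section ExteriorRing.
Variables (R : comNzRingType) (n : nat).
Local Notation E := (exterior R n).
Implicit Types (a b c : E) (A B C S : {set 'I_n}).

Definition basis_vec S : E := [ffun T : {set 'I_n} => (T == S)%:R].

Definition ext_mul a b : E :=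
  [ffun S : {set 'I_n} => \sum_(A : {set 'I_n} | A \subset S)
      (-1) ^+ inversions A (S :\: A) * a A * b (S :\: A)].

Lemma sum_setU (F : 'I_n -> nat) A B : [disjoint A & B] ->
  (\sum_(i in A :|: B) F i = \sum_(i in A) F i + \sum_(i in B) F i)%N.
Proof.
by move=> dAB; rewrite -bigU //=; apply: eq_bigl => i; rewrite !inE.
Qed.

Lemma inv0s A : inversions set0 A = 0%N.
Proof. by rewrite /inversions big_set0. Qed.

Lemma invs0 A : inversions A set0 = 0%N.
Proof. by rewrite /inversions big1 // => i _; rewrite big_set0. Qed.

Lemma invUl A B C : [disjoint A & B] ->
  inversions (A :|: B) C = (inversions A C + inversions B C)%N.
Proof. by move=> dAB; rewrite /inversions sum_setU. Qed.

Lemma invUr A B C : [disjoint B & C] ->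
  inversions A (B :|: C) = (inversions A B + inversions A C)%N.
Proof.
move=> dBC; rewrite /inversions -big_split /=; apply: eq_bigr => i _.
by rewrite sum_setU.
Qed.

Lemma ext_mulA : associative ext_mul.
Proof.
move=> a b c; apply/ffunP=> S; rewrite !ffunE.
transitivity (\sum_(D : {set 'I_n} | D \subset S)
  \sum_(A : {set 'I_n} | A \subset D)
   (-1) ^+ inversions D (S :\: D) * ((-1) ^+ inversions A (D :\: A) * a A * b (D :\: A))
     * c (S :\: D)); last first.
  apply: eq_bigr => D _; rewrite ffunE mulr_sumr mulr_suml.
  by apply: eq_bigr.
rewrite (exchange_big_dep (fun A => A \subset S)) /=; last first.
  by move=> D A DS AD; apply: subset_trans AD DS.
apply: eq_bigr => A AS; rewrite ffunE mulr_sumr.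
rewrite (reindex_onto (fun D => D :\: A) (fun B => A :|: B)) /=; last first.
  move=> B; rewrite subsetD => /andP[_ dBA].
  by rewrite setDUl setDv set0U; apply/setDidPl.
apply: eq_big => [D|D /andP[]].
  apply/andP/andP.
    case=> sDS /eqP <-; split; last exact: subsetUl.
    rewrite subUset AS /=; apply: subset_trans sDS _; exact: subsetDl.
  case=> DS AD; split; first exact: setSD.
  by apply/eqP; apply/setP=> x; rewrite !inE; case: (boolP (x \in A)) => //= xA;
    rewrite (subsetP AD _ xA).
move=> sDS /eqP eD; have AD : A \subset D by rewrite -eD subsetUl.
have e1 : S :\: A :\: (D :\: A) = S :\: D.
  apply/setP=> x; rewrite !inE; case: (boolP (x \in A)) => //= xA.
  by rewrite (subsetP AD _ xA).
have e2 : S :\: A = (D :\: A) :|: (S :\: D).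
  have DS : D \subset S.
    rewrite -eD subUset AS; apply: subset_trans sDS _; exact: subsetDl.
  apply/setP=> x; rewrite !inE; case: (boolP (x \in A)) => //= xA.
    by rewrite (subsetP AD _ xA).
  by case: (boolP (x \in D)) => //= xD; rewrite (subsetP DS _ xD).
have d2 : [disjoint D :\: A & S :\: D].
  by rewrite -setI_eq0; apply/eqP/setP=> x; rewrite !inE; case: (x \in D);
    rewrite ?andbF.
have e3 : inversions A (S :\: A) = (inversions A (D :\: A) + inversions A (S :\: D))%N.
  by rewrite e2 invUr.
have e4 : inversions D (S :\: D) = (inversions A (S :\: D) + inversions (D :\: A) (S :\: D))%N.
  rewrite -{1}eD invUl // -setI_eq0; apply/eqP/setP=> x.
  by rewrite !inE; case: (x \in A).
rewrite e1 e3 e4 !exprD.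
by ring.
Qed.

Lemma ext_mul1l : left_id (basis_vec set0) ext_mul.
Proof.
move=> a; apply/ffunP=> S; rewrite ffunE (bigD1 set0) ?sub0set //= big1.
  by rewrite inv0s setD0 ffunE eqxx !mul1r addr0.
by move=> A /andP[_ /negPf A0]; rewrite ffunE A0 mulr0 mul0r.
Qed.

Lemma ext_mul1r : right_id (basis_vec set0) ext_mul.
Proof.
move=> a; apply/ffunP=> S; rewrite ffunE (bigD1 S) //= big1.
  by rewrite setDv invs0 ffunE eqxx mul1r mulr1 addr0.
move=> A /andP[AS AnS]; rewrite ffunE setD_eq0.
case: (boolP (S \subset A)) => [SA|_]; last by rewrite mulr0.
by rewrite eqEsubset AS SA in AnS.
Qed.

Lemma ext_mulDl : left_distributive ext_mul +%R.
Proof.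
move=> a b c; apply/ffunP=> S; rewrite !ffunE -big_split /=.
by apply: eq_bigr => A _; rewrite ffunE mulrDr mulrDl.
Qed.

Lemma ext_mulDr : right_distributive ext_mul +%R.
Proof.
move=> a b c; apply/ffunP=> S; rewrite !ffunE -big_split /=.
by apply: eq_bigr => A _; rewrite ffunE mulrDr.
Qed.

Lemma ext_1_neq0 : basis_vec set0 != 0.
Proof.
apply/eqP=> /ffunP/(_ set0) /eqP; rewrite !ffunE eqxx.
by rewrite (negPf (oner_neq0 R)).
Qed.

HB.instance Definition _ := GRing.Zmodule_isNzRing.Build E
  ext_mulA ext_mul1l ext_mul1r ext_mulDl ext_mulDr ext_1_neq0.

Lemma ext_scaleAl (k : R) (a b : E) : k *: (a * b) = k *: a * b.
Proof.
apply/ffunP=> S; rewrite !ffunE scaler_sumr; apply: eq_bigr => A _.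
by rewrite !ffunE /GRing.scale /= !mulrA [k * _]mulrC.
Qed.

HB.instance Definition _ := GRing.Lmodule_isLalgebra.Build R E ext_scaleAl.

Lemma ext_scaleAr (k : R) (a b : E) : k *: (a * b) = a * (k *: b).
Proof.
apply/ffunP=> S; rewrite !ffunE scaler_sumr; apply: eq_bigr => A _.
by rewrite !ffunE /GRing.scale /= mulrCA.
Qed.

HB.instance Definition _ := GRing.Lalgebra_isAlgebra.Build R E ext_scaleAr.

End ExteriorRing.

Section ExteriorTheory.
Variables (R : comNzRingType) (n : nat).
Local Notation E := (exterior R n).
Implicit Types (a b c : E) (A B C S : {set 'I_n}) (i j : 'I_n).

Definition e_gen i : E := basis_vec R [set i].

(* enum S is increasing, so this is e_{i_1} ... e_{i_p} for
   S = {i_1 < ... < i_p}. *)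
Definition e_set S : E := \prod_(i <- enum S) e_gen i.

Definition homogeneous (p : nat) a : Prop :=
  forall S, #|S| != p -> a S = 0.

(* The coefficient of e_S in bd a collects, for i \notin S, the term of
   bd e_(i |: S) in which e_i is deleted. By bd_gen and bd_leibniz,
   this is the derivation sending every e_i to 1. *)
Definition bd a : E :=
  [ffun S : {set 'I_n} => \sum_(i | i \notin S) (-1) ^+ inversions [set i] S * a (i |: S)].

Lemma bdE a S :
  bd a S = \sum_(i | i \notin S) (-1) ^+ inversions [set i] S * a (i |: S).
Proof. by rewrite ffunE. Qed.

Lemma bd_is_linear : linear bd.
Proof.
move=> k a b; apply/ffunP=> S; rewrite !ffunE scaler_sumr -big_split /=.
by apply: eq_bigr => i _; rewrite !ffunE mulrDr /GRing.scale /= mulrCA.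
Qed.

HB.instance Definition _ := GRing.isLinear.Build R E E *:%R bd bd_is_linear.

Lemma ext_mulE a b S : (a * b) S =
  \sum_(A : {set 'I_n} | A \subset S)
      (-1) ^+ inversions A (S :\: A) * a A * b (S :\: A).
Proof. by rewrite /GRing.mul /= ffunE. Qed.

Lemma ext_oneE : 1 = basis_vec R set0 :> E.
Proof. by []. Qed.

Lemma basis_vec_mul A B : basis_vec R A * basis_vec R B =
  if [disjoint A & B] then (-1) ^+ inversions A B *: basis_vec R (A :|: B) else 0 :> E.
Proof.
apply/ffunP=> S; rewrite ext_mulE.
transitivity ((-1) ^+ inversions A (S :\: A) * ((A \subset S) && (S :\: A == B))%:R : R).
  case: (boolP (A \subset S)) => AS /=; last first.
    rewrite mulr0 big1 // => C CS; rewrite !ffunE; case: eqP => [eC|_].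
      by rewrite eC (negPf AS) in CS.
    by rewrite mulr0 mul0r.
  rewrite (bigD1 A) //= big1 => [|C /andP[_ /negPf CA]].
    by rewrite !ffunE eqxx mulr1 addr0.
  by rewrite !ffunE CA mulr0 mul0r.
have -> : (A \subset S) && (S :\: A == B) = [disjoint A & B] && (S == A :|: B).
  apply/andP/andP=> [[AS /eqP <-]|[dAB /eqP->]].
    split; first by rewrite -setI_eq0; apply/eqP/setP=> x; rewrite !inE; case: (x \in A).
    by apply/eqP/setP=> x; rewrite !inE; case: (boolP (x \in A)) => //= /(subsetP AS).
  split; first exact: subsetUl.
  by rewrite setDUl setDv set0U; apply/eqP/setDidPl; rewrite disjoint_sym.
case: ifP => dAB; rewrite !ffunE ?mulr0 //=.
case: eqP => [->|_]; last by rewrite !mulr0 /GRing.scale /= mulr0.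
rewrite setDUl setDv set0U; suff -> : B :\: A = B by [].
by apply/setDidPl; rewrite disjoint_sym.
Qed.

Lemma e_gen_sqr i : e_gen i * e_gen i = 0.
Proof. by rewrite /e_gen basis_vec_mul -setI_eq0 setIid -cards_eq0 cards1. Qed.

Lemma inv11 i j : inversions [set i] [set j] = (j < i)%N.
Proof. by rewrite /inversions !big_set1. Qed.

Lemma e_gen_anticomm i j : e_gen i * e_gen j = - (e_gen j * e_gen i).
Proof.
have [->|neq] := eqVneq i j; first by rewrite e_gen_sqr oppr0.
rewrite /e_gen !basis_vec_mul.
have d (x y : 'I_n) : x != y -> [disjoint [set x] & [set y]].
  by move=> xy; rewrite disjoints1 inE.
have neq' : j != i by rewrite eq_sym.
rewrite (d _ _ neq) (d _ _ neq') !inv11 setUC -scaleNr; congr (_ *: _).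
move: neq; rewrite -val_eqE /=.
by case: ltngtP => // _ _; rewrite /= expr0 expr1 ?opprK.
Qed.

Lemma bd_gen i : bd (e_gen i) = 1.
Proof.
apply/ffunP=> S; rewrite ext_oneE !ffunE.
have [->|S0] := eqVneq S set0.
  rewrite (bigD1 i) ?inE //= big1 => [|j /andP[_ ji]].
    by rewrite invs0 setU0 ffunE eqxx mul1r addr0.
  by rewrite setU0 ffunE (inj_eq set1_inj) (negPf ji) mulr0.
rewrite big1 // => j jS; rewrite ffunE; case: eqP => [e|]; last by rewrite mulr0.
case/set0Pn: S0 => x xS.
have /set1P xi : x \in [set i] by rewrite -e setU1r.
have /set1P ji : j \in [set i] by rewrite -e setU11.
by rewrite ji -xi xS in jS.
Qed.

Lemma homogeneous_bd p a : homogeneous p.+1 a -> homogeneous p (bd a).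
Proof.
move=> ha S Sp; rewrite ffunE big1 // => i iS.
by rewrite ha ?mulr0 // cardsU1 iS eqSS.
Qed.

Lemma homogeneous_basis_vec S : homogeneous #|S| (basis_vec R S).
Proof.
by move=> T neq; rewrite ffunE; case: eqP => // eT; rewrite eT eqxx in neq.
Qed.

Lemma inv_swap i A : i \notin A -> (inversions [set i] A + inversions A [set i])%N = #|A|.
Proof.
move=> iA; rewrite /inversions big_set1 -big_split -sum1_card /=.
apply: eq_bigr => j jA; rewrite big_set1.
have : j != i by apply: contraNneq iA => <-.
by rewrite -val_eqE /=; case: ltngtP.
Qed.

Lemma sum_subset_setU1 (F : {set 'I_n} -> R) i S : i \notin S ->
  \sum_(A : {set 'I_n} | A \subset i |: S) F A =
  \sum_(A : {set 'I_n} | A \subset S) F A +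
  \sum_(A : {set 'I_n} | A \subset S) F (i |: A).
Proof.
move=> iS; rewrite (bigID (fun A => i \notin A)) /=; congr (_ + _).
  by apply: eq_bigl => A; rewrite -subsetD1 setU1K.
rewrite (reindex_onto (fun A => i |: A) (fun B => B :\ i)) /=; last first.
  by move=> B /andP[_ iB]; rewrite setD1K // -[_ \in _]negbK.
apply: eq_bigl => A; rewrite setU11 andbT.
apply/andP/idP => [[/subsetP sA /eqP <-]|AS].
  apply/subsetP=> x; rewrite !inE => /andP[xi]; rewrite (negPf xi) /= => xA.
  by have /setU1P[xi'|//] := sA x (setU1r _ xA); rewrite xi' eqxx in xi.
split; first exact: setUS.
by apply/eqP/setU1K; apply: contra iS; apply: (subsetP AS).
Qed.

Lemma bd_leibniz p a b : homogeneous p a ->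
  bd (a * b) = bd a * b + (-1) ^+ p *: (a * bd b).
Proof.
move=> ha.
have sgA A : (-1) ^+ #|A| * a A = (-1) ^+ p * a A :> R.
  by have [->|/ha->] := eqVneq #|A| p; rewrite ?mulr0.
apply/ffunP=> S; rewrite bdE.
rewrite [RHS]ffunE [X in _ + X]ffunE /GRing.scale /= !ext_mulE.
pose F i A : R :=
  (-1) ^+ inversions A (S :\: A) * (-1) ^+ inversions [set i] A * a (i |: A) * b (S :\: A).
pose G i A : R := (-1) ^+ p * ((-1) ^+ inversions A (S :\: A) *
  (-1) ^+ inversions [set i] (S :\: A) * a A * b (i |: (S :\: A))).
transitivity (\sum_(A : {set 'I_n} | A \subset S) \sum_(i | i \notin S) F i A +
              \sum_(A : {set 'I_n} | A \subset S) \sum_(i | i \notin S) G i A).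
  rewrite (exchange_big_dep (fun i => i \notin S)) //=.
  rewrite [X in _ = _ + X](exchange_big_dep (fun i => i \notin S)) //=.
  rewrite -big_split /=; apply: eq_bigr => i iS.
  rewrite ext_mulE (sum_subset_setU1 _ iS) mulrDr [LHS]addrC !mulr_sumr.
  congr (_ + _); apply: eq_big => [A|A AS]; rewrite ?iS ?andbT //.
    have iA : i \notin A by apply: contra iS; apply: (subsetP AS).
    have dis : [disjoint [set i] & A] by rewrite disjoints1.
    have e1 : (i |: S) :\: (i |: A) = S :\: A.
      apply/setP=> x; rewrite !inE; have [->|] //= := eqVneq x i.
      by rewrite (negPf iS) andbF.
    rewrite /F e1 (invUl _ dis) -{1}(setID S A) (setIidPr AS) invUr; last first.
      by rewrite -setI_eq0 setIDA setIC -setIDA setDv setI0.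
    rewrite !exprD.
    transitivity ((-1) ^+ inversions [set i] (S :\: A) * (-1) ^+ inversions [set i] (S :\: A)
      * ((-1) ^+ inversions A (S :\: A) * (-1) ^+ inversions [set i] A * a (i |: A)
         * b (S :\: A)) : R); first by ring.
    by rewrite -exprD addnn -mul2n exprM sqrrN !expr1n mul1r.
  have iA : i \notin A by apply: contra iS; apply: (subsetP AS).
  have dis : [disjoint [set i] & S :\: A] by rewrite disjoints1 inE (negPf iS) andbF.
  have e1 : (i |: S) :\: A = i |: (S :\: A).
    by apply/setP=> x; rewrite !inE; have [->|] //= := eqVneq x i; rewrite iA.
  rewrite /G e1 (invUr _ dis) -{1}(setID S A) (setIidPr AS) invUr; last first.
    by rewrite -setI_eq0 setIDA setIC -setIDA setDv setI0.
  transitivity ((-1) ^+ (inversions [set i] A + inversions A [set i]) * a A *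
    ((-1) ^+ inversions A (S :\: A) * (-1) ^+ inversions [set i] (S :\: A) *
     b (i |: (S :\: A))) : R); first by rewrite !exprD; ring.
  by rewrite inv_swap // sgA; ring.
have EF : \sum_(A : {set 'I_n} | A \subset S)
    (-1) ^+ inversions A (S :\: A) * bd a A * b (S :\: A) =
  \sum_(A : {set 'I_n} | A \subset S) \sum_(i | i \notin S) F i A +
  \sum_(A : {set 'I_n} | A \subset S) \sum_(i in S :\: A) F i A.
  rewrite -big_split /=; apply: eq_bigr => A AS; rewrite ffunE.
  rewrite mulr_sumr mulr_suml (bigID (fun i => i \in S)) /= addrC.
  congr (_ + _); apply: eq_big => [i|i _]; rewrite /F ?inE ?mulrA //.
  by apply/andb_idl; apply: contra; apply: (subsetP AS).
have EG : (-1) ^+ p * (\sum_(A : {set 'I_n} | A \subset S)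
    (-1) ^+ inversions A (S :\: A) * a A * bd b (S :\: A)) =
  \sum_(A : {set 'I_n} | A \subset S) \sum_(i | i \notin S) G i A +
  \sum_(A : {set 'I_n} | A \subset S) \sum_(i in A) G i A.
  rewrite -big_split mulr_sumr /=; apply: eq_bigr => A AS; rewrite ffunE.
  rewrite !mulr_sumr (bigID (fun i => i \in S)) /= addrC.
  congr (_ + _); apply: eq_big => [i|i _]; rewrite /G ?inE; try by ring.
    by case: (boolP (i \in S)) => //=; rewrite !andbF.
  by case: (boolP (i \in A)) => [/(subsetP AS) ->|] //=; case: (i \in S).
have FG : \sum_(A : {set 'I_n} | A \subset S) \sum_(i in S :\: A) F i A +
          \sum_(A : {set 'I_n} | A \subset S) \sum_(i in A) G i A = 0.
  rewrite (exchange_big_dep (fun i => i \in S)) /=; last first.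
    by move=> A i _; rewrite inE => /andP[].
  rewrite [X in _ + X](exchange_big_dep (fun i => i \in S)) /=; last first.
    by move=> A i /subsetP; apply.
  rewrite -big_split big1 //= => i iS.
  rewrite [X in _ + X](reindex_onto (fun A => i |: A) (fun B => B :\ i)) /=;
    last by move=> B /andP[_ iB]; rewrite setD1K.
  rewrite [X in _ + X](eq_bigl (fun A => (A \subset S) && (i \in S :\: A)));
    last first.
    move=> A; rewrite setU11 andbT subUset sub1set iS inE iS andbT /=.
    congr (_ && _); apply/eqP/idP=> [<-|iA]; first by rewrite !inE eqxx.
    by rewrite setU1K.
  rewrite -big_split big1 //= => A /andP[AS]; rewrite inE => /andP[iA _].
  have dis : [disjoint [set i] & A] by rewrite disjoints1.
  have e0 : S :\: A = i |: (S :\: (i |: A)).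
    by apply/setP=> x; rewrite !inE; have [->|] //= := eqVneq x i; rewrite iA.
  have dis' : [disjoint [set i] & S :\: (i |: A)].
    by rewrite disjoints1 !inE eqxx.
  rewrite /F /G -e0 (invUl _ dis) {1}e0 (invUr _ dis').
  have hs : (-1) ^+ (inversions [set i] A + inversions A [set i]) * a (i |: A) =
            - ((-1) ^+ p * a (i |: A)) :> R.
    by rewrite inv_swap // -sgA cardsU1 iA exprS mulN1r mulNr opprK.
  set D := S :\: (i |: A).
  transitivity ((-1) ^+ (inversions [set i] A + inversions A [set i]) * a (i |: A) *
     ((-1) ^+ inversions A D * b (S :\: A)) +
     (-1) ^+ inversions [set i] D * (-1) ^+ inversions [set i] D *
     ((-1) ^+ p * a (i |: A)) * ((-1) ^+ inversions A D * b (S :\: A)) : R).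
    by rewrite !exprD; ring.
  rewrite hs -exprD addnn -mul2n exprM sqrrN !expr1n mul1r.
  by ring.
rewrite EF EG addrACA FG addr0.
by [].
Qed.

Lemma sorted_enum_set S : sorted (fun i j : 'I_n => i < j)%N (enum S).
Proof.
rewrite /enum_mem; apply: sorted_filter; first by move=> ? ? ?; apply: ltn_trans.
rewrite -enumT -[sorted _ _]/(sorted (relpre (val : 'I_n -> nat) ltn) _).
by rewrite -sorted_map val_enum_ord iota_ltn_sorted.
Qed.

Lemma e_setE S : e_set S = basis_vec R S.
Proof.
rewrite /e_set; have := sorted_enum_set S.
have {3}-> : S = [set i in enum S] by apply/setP=> i; rewrite inE mem_enum.
elim: (enum S) => [_|i s IH] /=.
  by rewrite big_nil ext_oneE; congr basis_vec; apply/setP=> i; rewrite !inE.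
move=> pth; rewrite big_cons IH ?(path_sorted pth) // {IH} /e_gen basis_vec_mul.
have lt_i j : j \in s -> (i < j)%N.
  apply/allP: j; apply: order_path_min pth.
  by move=> ? ? ?; apply: ltn_trans.
have -> : [set j in i :: s] = i |: [set j in s].
  by apply/setP=> j; rewrite !inE.
rewrite disjoints1 inE; case: (boolP (i \in s)) => [/lt_i|_] /=.
  by rewrite ltnn.
rewrite /inversions big_set1 big1 ?scale1r // => j; rewrite inE => /lt_i.
by rewrite ltnNge; case: ltngtP.
Qed.

End ExteriorTheory.

Definition two_sided_ideal (A : nzRingType) (J : A -> Prop) : Prop :=
  [/\ J 0,
      forall x y, J x -> J y -> J (x + y),
      forall a x, J x -> J (a * x)
    & forall a x, J x -> J (x * a)].

Definition ideal_gen (A : nzRingType) (G : A -> Prop) (x : A) : Prop :=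
  forall J : A -> Prop,
    two_sided_ideal J -> (forall g, G g -> J g) -> J x.

Definition annihilator (A : nzRingType) (J : A -> Prop) (a : A) : Prop :=
  forall b, J b -> a * b = 0.

(* The family (v i), i \in P, is a basis of the submodule N of V. *)
Definition is_basis_of (R : nzRingType) (V : lmodType R) (I : finType)
    (P : {set I}) (v : I -> V) (N : V -> Prop) : Prop :=
  [/\ forall i, i \in P -> N (v i),
      forall c : I -> R,
        \sum_(i in P) c i *: v i = 0 -> forall i, i \in P -> c i = 0
    & forall x, N x -> exists c : I -> R, x = \sum_(i in P) c i *: v i].

Record matroid (T : finType) := Matroid {
  indep : {set {set T}};
  indep0 : set0 \in indep;
  indepS : forall A B : {set T}, A \subset B -> B \in indep -> A \in indep;
  indep_aug : forall A B : {set T}, A \in indep -> B \in indep ->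
    (#|A| < #|B|)%N -> exists2 x, x \in B :\: A & x |: A \in indep
}.

Section Matroid.
Variables (T : finType) (M : matroid T).
Implicit Types (A B C : {set T}) (x y : T).

Definition dependent A : bool := A \notin indep M.

Definition circuit C : bool := minset dependent C.

Definition rk A : nat := \max_(B in indep M | B \subset A) #|B|.

Definition rank : nat := rk setT.

Definition cl A : {set T} := [set x | rk (x |: A) == rk A].

Definition simple_matroid : Prop :=
  (forall x, ~~ circuit [set x]) /\
  (forall x y, x != y -> ~~ circuit [set x; y]).

Lemma rk_ge A B : B \in indep M -> B \subset A -> (#|B| <= rk A)%N.
Proof. by move=> iB BA; apply: (leq_bigmax_cond B); rewrite iB. Qed.

Lemma rk_ex A : exists2 B, B \in indep M & B \subset A /\ #|B| = rk A.
Proof.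
have [|B /andP[iB BA] e] := @eq_bigmax_cond _
  (fun B => (B \in indep M) && (B \subset A)) (fun B => #|B|).
  by apply/card_gt0P; exists set0; rewrite unfold_in indep0 sub0set.
by exists B.
Qed.

Lemma rkS A B : A \subset B -> (rk A <= rk B)%N.
Proof.
by move=> AB; have [C iC [CA <-]] := rk_ex A; apply/rk_ge/(subset_trans CA).
Qed.

Lemma indep_extend A B : A \in indep M -> A \subset B ->
  exists2 C, C \in indep M & [/\ A \subset C, C \subset B & #|C| = rk B].
Proof.
move: {2}(rk B - #|A|)%N (leqnn (rk B - #|A|)) => k.
elim: k A => [|k IH] A; rewrite ?leqn0 => hk iA AB.
  exists A => //; split=> //; apply/eqP; rewrite eqn_leq; apply/andP; split.
    exact: rk_ge.
  by rewrite -subn_eq0.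
have [lt|ge] := ltnP #|A| (rk B); last first.
  by exists A => //; split=> //; apply/eqP; rewrite eqn_leq rk_ge.
have [D iD [DB eD]] := rk_ex B; rewrite -eD in lt.
have [x /setDP[xD xA] iAx] := indep_aug iA iD lt.
have [||C iC [sC CB eC]] := IH (x |: A) _ iAx.
- by rewrite cardsU1 xA /= add1n subnS; case: (rk B - #|A|)%N hk.
- by rewrite subUset sub1set AB (subsetP DB _ xD).
by exists C => //; split=> //; apply: subset_trans sC; apply: subsetUr.
Qed.

Lemma sub_cl A : A \subset cl A.
Proof.
apply/subsetP=> x xA; rewrite inE; suff -> : x |: A = A by [].
by apply/setUidPr; rewrite sub1set.
Qed.

Lemma clS A B : A \subset B -> cl A \subset cl B.
Proof.
move=> AB; apply/subsetP=> x; rewrite !inE => /eqP eA.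
rewrite eqn_leq (rkS (subsetUr [set x] B)) andbT leqNgt; apply/negP=> lt.
have [I iI [IA cI]] := rk_ex A.
have [J iJ [IJ JB cJ]] := indep_extend iI (subset_trans IA AB).
have [K iK [KB cK]] := rk_ex (x |: B).
rewrite -cJ -cK in lt.
have [y /setDP[yK yJ] iyJ] := indep_aug iJ iK lt.
have [yB|yB] := boolP (y \in B).
  have := rk_ge iyJ (A := B); rewrite subUset sub1set yB JB => /(_ isT).
  by rewrite cardsU1 yJ cJ ltnn.
have /setU1P[yx|] := subsetP KB _ yK; last by rewrite (negPf yB).
have iyI : y |: I \in indep M by apply: indepS iyJ; apply: setUS.
have := rk_ge iyI (A := x |: A).
rewrite yx setUS // => /(_ isT); rewrite eA cardsU1 cI.
by rewrite -yx (contra (subsetP IJ y) yJ) ltnn.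
Qed.

End Matroid.

(* The permutation i |-> s_i, for s listing 'I_n without repetition. *)
Definition perm_of_seq n (s : seq 'I_n) : 'S_n :=
  insubd (1%g : 'S_n) [ffun i : 'I_n => nth i s i].

Lemma perm_of_seqE n (s : seq 'I_n) (i : 'I_n) :
  perm_eq s (enum 'I_n) -> perm_of_seq s i = nth i s i.
Proof.
move=> /[dup] /perm_uniq us /perm_size; rewrite enum_uniq in us.
rewrite size_enum_ord => ss.
have -> : nth i s i = [ffun i : 'I_n => nth i s i] i by rewrite ffunE.
rewrite -pvalE /perm_of_seq val_insubd ifT //.
apply/injectiveP=> j k; rewrite !ffunE (set_nth_default k) ?ss // => /eqP.
by rewrite nth_uniq ?ss // => /eqP/val_inj.
Qed.

Section OrlikSolomon.
Variables (R : comNzRingType) (n : nat) (M : matroid 'I_n).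
Implicit Types (B C S T : {set 'I_n}) (p q : nat).
Local Notation E := (exterior R n).

(* The ground set {1, ..., n} is represented by 'I_n = {0, ..., n-1}. *)
Definition broken_circuit B : bool :=
  [exists C : {set 'I_n}, circuit M C &&
    [exists x in C, [forall y in C, (x <= y)%N] && (B == C :\ x)]].

Definition nbc T : bool :=
  [forall B : {set 'I_n}, broken_circuit B ==> ~~ (B \subset T)].

Definition nbc_sets p : {set {set 'I_n}} := [set T | nbc T & #|T| == p].

Definition OS_ideal : E -> Prop :=
  ideal_gen (fun g : E => exists2 S, dependent M S & g = bd (e_set R S)).

(* X_0 = set0, and X_q is the closure of the q largest elements of T *)
Definition zX T q : {set 'I_n} :=
  if q is 0 then set0 else cl M [set i in drop (#|T| - q) (enum T)].

Definition zS T q : {set 'I_n} := zX T q :\: zX T q.-1.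

Definition zlisting T : seq 'I_n :=
  flatten [seq enum (zS T q) | q <- iota 1 #|T|] ++ enum (~: zX T #|T|).

Definition z T : E :=
  (-1) ^+ perm_of_seq (zlisting T) *:
    ((\prod_(1 <= q < #|T|.+1) bd (e_set R (zS T q)))
       * e_set R (~: zX T #|T|)).

Lemma zXS T q r : (q <= r)%N -> zX T q \subset zX T r.
Proof.
case: q => [|q]; first by rewrite sub0set.
case: r => // r qr; apply: clS; apply/subsetP=> i; rewrite !inE.
by rewrite -(subnK (leq_sub2l #|T| qr)) -drop_drop => /mem_drop.
Qed.

Lemma mem_zS_flatten T m i :
  (i \in flatten [seq enum (zS T q) | q <- iota 1 m]) = (i \in zX T m).
Proof.
elim: m => [|m IH]; first by rewrite inE.
rewrite -[in LHS](addn1 m) iotaD map_cat flatten_cat mem_cat IH add1n /= cats0.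
rewrite mem_enum inE; case: (boolP (i \in zX T m)) => //= iX.
by rewrite (subsetP (zXS T (leqnSn m)) _ iX).
Qed.

(* Hence the sign in z T is that of the listing of S_1, S_2, ..., [n] \ X_p. *)
Lemma zlisting_perm T : perm_eq (zlisting T) (enum 'I_n).
Proof.
apply: uniq_perm; rewrite ?enum_uniq //; last first.
  by move=> i; rewrite mem_cat mem_zS_flatten !mem_enum inE orbN.
rewrite cat_uniq enum_uniq andbT; apply/andP; split; last first.
  by apply/hasPn=> i; rewrite mem_enum inE /= mem_zS_flatten.
elim: #|T| => [//|m IH].
rewrite -(addn1 m) iotaD map_cat flatten_cat cat_uniq IH /= cats0 enum_uniq andbT.
by apply/hasPn=> i; rewrite mem_enum inE add1n /= mem_zS_flatten => /andP[].
Qed.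

Lemma perm_of_zlisting T i :
  perm_of_seq (zlisting T) i = nth i (zlisting T) i.
Proof. exact/perm_of_seqE/zlisting_perm. Qed.


End OrlikSolomon.

Arguments OS_ideal R {n} M _.
Arguments z R {n} M T.

(* Main.v *)
Require Import Defs.
From mathcomp Require Import all_boot all_order all_fingroup all_algebra.
From mathcomp Require Import ring.

Set Implicit Arguments.
Unset Strict Implicit.
Unset Printing Implicit Defensive.

Import GRing.Theory.

(* Since e_T times a is, up to sign, the coefficient of a at the complement of T,
   the degree n-p part of the annihilator embeds into the dual of E_p / I_p.
   - Every z(T) annihilates I: the product P of the factors bd(e_(S_q)) satisfies
     bd P = 0, and P e_S = 0 for dependent S inside X_p, since such an S meets some
     block S_q twice (a set meeting each X_q \ X_(q-1) at most once is independent).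
   - The nbc monomials span E_p modulo I, so an element of the annihilator is
     determined by its coefficients at complements of nbc sets.
   - For nbc sets T and T', the coefficient of z(T) at the complement of T' is +-1
     or 0; it is nonzero iff T' lies in X_p and meets every block S_q exactly once.
     As T meets S_q in the minimum of X_q, the matrix of these coefficients is
     triangular, for the order by sum of elements, with diagonal entries +-1. *)

(** * Triangular linear systems over a commutative ring *)

Section TriangularSystems.
Local Open Scope ring_scope.
Variables (R : comNzRingType) (I : finType) (P : {set I}) (w : I -> nat).
Variable m : I -> I -> R.
(** Diagonal entries are self-inverse, as signs are over any ring. Ties of [w] are allowed, with
    zero entries between distinct tied indices. *)
Hypothesis m_diag : forall i, i \in P -> m i i * m i i = 1.
Hypothesis m_trig : forall i j, i \in P -> j \in P ->
  i != j -> (w j <= w i)%N -> m i j = 0.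

Lemma triangular_inj (c : I -> R) :
  (forall j, j \in P -> \sum_(i in P) c i * m i j = 0) ->
  forall j, j \in P -> c j = 0.
Proof.
move=> c0 j; move: {2}(w j).+1 (ltnSn (w j)) => k.
elim: k j => // k IH j; rewrite ltnS => wj jP.
have := c0 j jP; rewrite (bigD1 j) //= big1 => [|i /andP[iP ij]].
  by rewrite addr0 => e; rewrite -[c j]mulr1 -(m_diag jP) mulrA e mul0r.
have [le|lt] := leqP (w j) (w i); first by rewrite m_trig // mulr0.
by rewrite IH ?mul0r // (leq_trans lt).
Qed.

Lemma triangular_surj (b : I -> R) :
  exists c : I -> R, forall j, j \in P -> \sum_(i in P) c i * m i j = b j.
Proof.
suff c k : exists c : I -> R, forall j, j \in P -> (w j < k)%N ->
    \sum_(i in P) c i * m i j = b j.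
  have [d hd] := c (\max_i w i).+1.
  by exists d => j jP; apply: hd jP _; rewrite ltnS leq_bigmax.
elim: k => [|k [c hc]]; first by exists (fun=> 0).
pose r i := b i - \sum_(i' in P) c i' * m i' i.
(* As [m i i] is its own inverse, this correction solves the equations of weight [k]; by [m_trig] it
   leaves those of smaller weight unchanged. *)
exists (fun i => c i + (w i == k)%:R * (m i i * r i)) => j jP; rewrite ltnS => wj.
under eq_bigr do rewrite mulrDl.
rewrite big_split /= [X in _ + X](bigD1 j) //= [X in _ + (_ + X)]big1 => [|i /andP[iP ij]].
  rewrite addr0; have [e|ne] := eqVneq (w j) k.
    by rewrite mul1r mulrAC m_diag // mul1r /r addrC subrK.
  by rewrite !mul0r addr0 hc // ltn_neqAle ne.
have [e|_] := eqVneq (w i) k; last by rewrite !mul0r.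
by rewrite [m i j]m_trig ?mulr0 // e.
Qed.

End TriangularSystems.

(** * Coefficients and boundaries in the exterior algebra *)

Section Exterior.
Local Open Scope ring_scope.
Variables (R : comNzRingType) (n : nat).
Local Notation E := (exterior R n).
Implicit Types (a b c : E) (A B C S U : {set 'I_n}).

Lemma ext_basisE a : a = \sum_S a S *: basis_vec R S.
Proof.
apply/ffunP=> U; rewrite sum_ffunE (bigD1 U) //= big1 => [|S neq].
  by rewrite !ffunE eqxx /GRing.scale /= mulr1 addr0.
by rewrite !ffunE eq_sym (negPf neq) /GRing.scale /= mulr0.
Qed.

Lemma disjoint_setDr A B : [disjoint A & B :\: A].
Proof. by rewrite -setI_eq0 setIDA setIC -setIDA setDv setI0. Qed.

Lemma inversions_swap A B : [disjoint A & B] ->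
  (inversions A B + inversions B A)%N = (#|A| * #|B|)%N.
Proof.
move=> dAB; rewrite {2}/inversions exchange_big -big_split /= -sum_nat_const.
apply: eq_bigr => i iA; rewrite -big_split -sum1_card /=.
apply: eq_bigr => j jB; have : i != j by apply: contraTneq iA => ->; rewrite (disjointFl dAB).
by rewrite -val_eqE /=; case: ltngtP.
Qed.

Lemma sign_sqr k : (-1) ^+ k * (-1) ^+ k = 1 :> R.
Proof. by rewrite -exprD addnn -mul2n exprM sqrrN !expr1n. Qed.

Lemma ext_mulC p q a b : homogeneous p a -> homogeneous q b ->
  a * b = (-1) ^+ (p * q) *: (b * a).
Proof.
move=> ha hb; apply/ffunP=> S; rewrite [RHS]ffunE /GRing.scale /= !ext_mulE.
rewrite mulr_sumr (reindex_onto (fun A => S :\: A) (fun A => S :\: A)) /=; last first.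
  by move=> A AS; rewrite setDDr setDv set0U (setIidPr AS).
apply: eq_big => A; first by rewrite subsetDl setDDr setDv set0U (sameP eqP setIidPr).
move=> /andP[_ /eqP eA]; rewrite eA; set B := S :\: A.
have [eB|/ha->] := eqVneq #|B| p; last by rewrite !mulr0 mul0r.
have [eA'|/hb->] := eqVneq #|A| q; last by rewrite !mulr0 mul0r mulr0.
rewrite -eB -eA' mulnC -(@inversions_swap A B) ?disjoint_setDr // exprD.
transitivity ((-1) ^+ inversions A B * (-1) ^+ inversions A B *
  ((-1) ^+ inversions B A * a B * b A) : R); last by ring.
by rewrite sign_sqr mul1r.
Qed.

Lemma homogeneous_mul p q a b : homogeneous p a -> homogeneous q b ->
  homogeneous (p + q) (a * b).
Proof.
move=> ha hb S Spq; rewrite ext_mulE big1 // => A AS.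
have [eA|/ha->] := eqVneq #|A| p; last by rewrite !mulr0 mul0r.
rewrite hb ?mulr0 //; apply: contraNneq Spq => eB.
by rewrite -eA -eB cardsD (setIidPr AS) subnKC // subset_leq_card.
Qed.

Lemma mul_basis_vecE a S U : (a * basis_vec R S) U =
  if S \subset U then (-1) ^+ inversions (U :\: S) S * a (U :\: S) else 0.
Proof.
rewrite ext_mulE; case: ifPn => SU.
  rewrite (bigD1 (U :\: S)) ?subsetDl //= big1 => [|A /andP[AU neq]].
    by rewrite setDDr setDv set0U (setIidPr SU) ffunE eqxx mulr1 addr0.
  rewrite ffunE; case: eqP => [e|_]; last by rewrite mulr0.
  by case/eqP: neq; rewrite -e setDDr setDv set0U (setIidPr AU).
rewrite big1 // => A AU; rewrite ffunE; case: eqP => [e|_]; last by rewrite mulr0.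
by rewrite -e subsetDl in SU.
Qed.

(** Induction on the size of [S]: up to sign e_S is e_i e_(S :\ i), and applying the Leibniz rule
    twice makes the two copies of bd e_(S :\ i) cancel. *)
Lemma bd_basis_vec_bd S : bd (bd (basis_vec R S)) = 0.
Proof.
elim: {S}#|S| {-2}S (erefl #|S|) => [|k IH] S.
  move/eqP; rewrite cards_eq0 => /eqP->.
  have -> : bd (basis_vec R set0) = 0 :> E; last by rewrite linear0.
  apply/ffunP=> U; rewrite !ffunE big1 // => i _; rewrite ffunE.
  by case: eqP => [/setP/(_ i)|_]; rewrite ?mulr0 // !inE eqxx.
move=> eS; have /card_gt0P[i iS] : (0 < #|S|)%N by rewrite eS.
have dis : [disjoint [set i] & S :\ i] by rewrite disjoints1 !inE eqxx.
have : e_gen R i * basis_vec R (S :\ i) =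
    (-1) ^+ inversions [set i] (S :\ i) *: basis_vec R S.
  by rewrite basis_vec_mul dis setD1K.
move/(congr1 (fun a => bd (bd a))); rewrite !linearZ /=.
have hi : homogeneous 1 (e_gen R i) by rewrite -(cards1 i); apply: homogeneous_basis_vec.
rewrite (bd_leibniz _ hi) bd_gen mul1r expr1 scaleN1r linearB /= (bd_leibniz _ hi) bd_gen mul1r.
rewrite IH ?mulr0 ?scaler0 ?addr0 ?subrr; last first.
  by move: eS; rewrite (cardsD1 i S) iS => -[].
move/(congr1 (fun a => (-1) ^+ inversions [set i] (S :\ i) *: a)).
by rewrite scaler0 scalerA sign_sqr scale1r.
Qed.

(** The signs are left unspecified: only the vanishing or invertibility of coefficients matters
    below. *)
Definition signed_indicator a (G : pred {set 'I_n}) : Prop :=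
  forall U, if G U then exists k : nat, a U = (-1) ^+ k else a U = 0.

Lemma signed_indicator0 a G U : signed_indicator a G -> ~~ G U -> a U = 0.
Proof. by move/(_ U) => h; case: ifP h. Qed.

Lemma signed_indicator_eq a G G' :
  G =1 G' -> signed_indicator a G -> signed_indicator a G'.
Proof. by move=> eG ha U; rewrite -eG; apply: ha. Qed.

Lemma signed_indicator_scale k a G :
  signed_indicator a G -> signed_indicator ((-1) ^+ k *: a) G.
Proof.
move=> ha U; have := ha U; rewrite ffunE /GRing.scale /=.
by case: ifP => _ => [[l ->]|->]; [exists (k + l)%N; rewrite exprD | rewrite mulr0].
Qed.

Lemma basis_vec_signed S : signed_indicator (basis_vec R S) (pred1 S).
Proof. by move=> U; rewrite ffunE /=; case: eqP => // _; exists 0%N. Qed.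

Lemma bd_basis_vec_signed S :
  signed_indicator (bd (basis_vec R S)) (fun U => (U \subset S) && (#|S :\: U| == 1%N)).
Proof.
move=> U; rewrite bdE; case: ifP => [/andP[US /cards1P[x ex]]|nG].
  have : x \in S :\: U by rewrite ex set11.
  rewrite inE => /andP[xU xS]; have eS : x |: U = S.
    by rewrite setUC -ex -{1}(setIidPr US) setID.
  exists (inversions [set x] U); rewrite (bigD1 x) //= big1 => [|i /andP[iU ix]].
    by rewrite ffunE eS eqxx mulr1 addr0.
  rewrite ffunE; case: eqP => [e|_]; last by rewrite mulr0.
  have : i \in S :\: U by rewrite inE iU -e setU11.
  by rewrite ex inE (negPf ix).
rewrite big1 // => i iU; rewrite ffunE; case: eqP => [e|_]; last by rewrite mulr0.
case/negP: (negbT nG); rewrite -e subsetUr setDUl setDv setU0.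
by have /setDidPl-> : [disjoint [set i] & U]; rewrite ?disjoints1 ?cards1.
Qed.

(** Because the supports live on disjoint ground sets, only the splitting of [U] into [U :&: A] and
    [U :&: B] can contribute, so no two signs are ever added. *)
Lemma signed_indicator_mul A B a b (G H : pred {set 'I_n}) :
  [disjoint A & B] ->
  signed_indicator a G -> (forall U, G U -> U \subset A) ->
  signed_indicator b H -> (forall U, H U -> U \subset B) ->
  signed_indicator (a * b)
    (fun U => [&& U \subset A :|: B, G (U :&: A) & H (U :&: B)]).
Proof.
move=> dAB ha GA hb HB U; rewrite ext_mulE.
have zero C : C \subset U -> ~~ [&& U \subset A :|: B, C == U :&: A, G (U :&: A) & H (U :&: B)] ->
    (-1) ^+ inversions C (U :\: C) * a C * b (U :\: C) = 0.
  move=> CU; have [GC|nGC] := boolP (G C); last first.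
    by rewrite (signed_indicator0 ha nGC) mulr0 mul0r.
  have [HC|nHC] := boolP (H (U :\: C)); last by rewrite (signed_indicator0 hb nHC) mulr0.
  have CA := GA _ GC; have UCB := HB _ HC.
  have UAB : U \subset A :|: B.
    apply/subsetP=> x xU; rewrite inE; case: (boolP (x \in C)) => [/(subsetP CA)->//|xC].
    by rewrite (subsetP UCB) ?orbT // inE xC.
  have eC : C = U :&: A.
    apply/setP=> x; rewrite inE; case: (boolP (x \in C)) => [xC|xC].
      by rewrite (subsetP CU) // (subsetP CA).
    case: (boolP (x \in U)) => //= xU; rewrite (disjointFl dAB) //.
    by rewrite (subsetP UCB) // inE xC.
  have eD : U :\: C = U :&: B.
    apply/setP=> x; rewrite eC !inE; case: (boolP (x \in U)) => xU; rewrite ?andbF //= andbT.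
    have := subsetP UAB _ xU; rewrite inE; case: (boolP (x \in A)) => //= xA.
    by rewrite (disjointFr dAB).
  by rewrite UAB -eD -{1}eC eqxx -{1}eC GC HC.
case: ifP => [/and3P[UAB GU HU]|nG]; last first.
  by rewrite big1 // => C /zero-> //; rewrite andbCA nG andbF.
rewrite (bigD1 (U :&: A)) ?subsetIl //= big1 => [|C /andP[/zero z0 neq]]; last first.
  by apply: z0; rewrite (negPf neq) andbF.
have -> : U :\: (U :&: A) = U :&: B.
  apply/setP=> x; rewrite !inE; case: (boolP (x \in U)) => xU; rewrite ?andbF //= andbT.
  have := subsetP UAB _ xU; rewrite inE; case: (boolP (x \in A)) => //= xA.
  by rewrite (disjointFr dAB).
have := ha (U :&: A); have := hb (U :&: B); rewrite GU HU => -[k ->] [l ->].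
by exists (inversions (U :&: A) (U :&: B) + l + k)%N; rewrite addr0 !exprD.
Qed.

End Exterior.

(** * Closure, independence and circuits *)

Section MatroidClosure.
Variables (T : finType) (M : matroid T).
Implicit Types (A B C D S : {set T}) (x y : T).

Lemma rk_indep A : A \in indep M -> rk M A = #|A|.
Proof.
move=> iA; apply/eqP; rewrite eqn_leq (rk_ge iA) // andbT.
by have [B _ [BA <-]] := rk_ex M A; apply: subset_leq_card.
Qed.

Lemma setU1_cl_dependent D x : D \in indep M -> x \in cl M D -> x \notin D ->
  dependent M (x |: D).
Proof.
move=> iD; rewrite inE => /eqP e xD; apply/negP=> ixD.
by move: e; rewrite !rk_indep // cardsU1 xD /= => /eqP; rewrite add1n -[_ == _]negbK gtn_eqF.
Qed.

Lemma rk_cl D : rk M (cl M D) = rk M D.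
Proof.
apply/eqP; rewrite eqn_leq (rkS M (sub_cl M D)) andbT leqNgt; apply/negP=> lt.
have [J iJ [JD cJ]] := rk_ex M D; have [K iK [KD cK]] := rk_ex M (cl M D).
rewrite -cJ -cK in lt; have [y /setDP[yK yJ] iyJ] := indep_aug iJ iK lt.
have := subsetP KD y yK; rewrite inE => /eqP e.
have := rk_ge iyJ (setUS [set y] JD); rewrite e -cJ cardsU1 yJ.
by rewrite ltnn.
Qed.

(** Extend [A] to a basis [C] of [cl M D]. The rank of [x |: D] is larger, so [C] can be augmented
    inside [x |: D]; by maximality of [C] in the closure, the new element is [x]. *)
Lemma indep_setU1_cl D A x : A \in indep M -> A \subset cl M D ->
  x \notin cl M D -> x |: A \in indep M.
Proof.
move=> iA AD xD; have [C iC [AC CD cC]] := indep_extend iA AD.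
rewrite rk_cl in cC.
have lt : (#|C| < rk M (x |: D))%N.
  by rewrite cC ltn_neqAle eq_sym rkS ?subsetUr // andbT; move: xD; rewrite inE.
have [K iK [KD cK]] := rk_ex M (x |: D); rewrite -cK in lt.
have [y /setDP[yK yC] iyC] := indep_aug iC iK lt.
have [yx|yD] := setU1P (subsetP KD y yK).
  by apply: indepS iyC; rewrite yx setUS.
have := @rk_ge _ M (cl M D) _ iyC; rewrite rk_cl -cC subUset sub1set CD.
by rewrite (subsetP (sub_cl M D)) // cardsU1 yC ltnn => /(_ isT).
Qed.

Lemma dependent_circuit A : dependent M A -> exists2 C, circuit M C & C \subset A.
Proof. by move=> dA; have [C] := minset_exists dA; exists C. Qed.

Lemma circuit_neq0 C : circuit M C -> C != set0.
Proof. by move/minsetp; apply: contraNneq => ->; apply: indep0. Qed.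

(** A point of [cl M set0] would be a loop. This makes X_0 the closure of the empty set, as used in
    [zXE]. *)
Lemma simple_cl0 : simple_matroid M -> cl M set0 = set0.
Proof.
case=> noloop _; apply/setP=> x; rewrite in_set0; apply/negP=> xc.
have := setU1_cl_dependent (indep0 M) xc; rewrite inE setU0 => /(_ isT).
case/dependent_circuit=> C cC; rewrite subset1 (negPf (circuit_neq0 cC)) orbF.
by move/eqP=> eC; move: (noloop x); rewrite -eC cC.
Qed.

End MatroidClosure.

(** * The flats and blocks of an nbc set, and their transversals *)

Section NbcSets.
Variables (n : nat) (M : matroid 'I_n).
Implicit Types (B C D S T U : {set 'I_n}) (i j t x : 'I_n).

Lemma set_min C : C != set0 -> exists2 x, x \in C & forall y, y \in C -> (x <= y)%N.
Proof.
case/set0Pn=> i iC; case: (@arg_minnP _ i (mem C) val iC) => x xC h.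
by exists x.
Qed.

Lemma nbc_circuit C T x : nbc M T -> circuit M C -> x \in C ->
  (forall y, y \in C -> (x <= y)%N) -> ~~ (C :\ x \subset T).
Proof.
move/forallP/(_ (C :\ x))/implyP=> h cC xC minx; apply: h.
apply/existsP; exists C; rewrite cC; apply/existsP; exists x; rewrite xC eqxx andbT.
by apply/forallP=> y; apply/implyP/minx.
Qed.

Lemma nbc_indep T : nbc M T -> T \in indep M.
Proof.
move=> nT; apply: contraT => /dependent_circuit[C cC CT].
have [x xC minx] := set_min (circuit_neq0 cC).
by case/negP: (nbc_circuit nT cC xC minx); apply: subset_trans CT; apply: subsetDl.
Qed.

(** Otherwise [j |: D] would contain a circuit with minimum [j], whose broken circuit lies in [D]
    and so in [T]. *)
Lemma nbc_cl_lt T D j : nbc M T -> D \subset T ->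
  (forall i, i \in D -> (j < i)%N) -> j \notin cl M D.
Proof.
move=> nT DT lt; apply/negP=> jcl.
have iD := indepS DT (nbc_indep nT).
have jD : j \notin D by apply/negP=> /lt; rewrite ltnn.
have [C cC CjD] := dependent_circuit (setU1_cl_dependent iD jcl jD).
have CjDs : C :\ j \subset D by rewrite subDset.
have jC : j \in C.
  apply: contraT => jC; case/negP: (minsetp cC); apply: indepS iD.
  by apply: subset_trans CjDs; rewrite subsetD1 subxx.
have minj y : y \in C -> (j <= y)%N by move=> /(subsetP CjD)/setU1P[->//|/lt/ltnW].
by case/negP: (nbc_circuit nT cC jC minj); apply: subset_trans DT.
Qed.

Lemma non_nbc_exchange S : ~~ nbc M S -> exists C, exists x,
  [/\ circuit M C, x \in C, forall y, y \in C :\ x -> (x < y)%N & C :\ x \subset S].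
Proof.
rewrite negb_forall => /existsP[B]; rewrite negb_imply negbK.
case/andP=> /existsP[C /andP[cC /existsP[x /andP[xC /andP[/forallP minx /eqP->]]]]] CS.
exists C; exists x; split=> // y /setD1P[yx yC].
by rewrite ltn_neqAle (implyP (minx y) yC) andbT eq_sym.
Qed.

Definition largest T q : {set 'I_n} := [set i in drop (#|T| - q) (enum T)].

Lemma largest_sub T q : largest T q \subset T.
Proof. by apply/subsetP=> i; rewrite inE => /mem_drop; rewrite mem_enum. Qed.

Lemma largest_lt T q i j : i \in T -> i \notin largest T q -> j \in largest T q ->
  (i < j)%N.
Proof.
move=> iT; have := sorted_enum_set T.
rewrite sorted_pairwise; last by move=> ? ? ?; apply: ltn_trans.
rewrite -{1}(cat_take_drop (#|T| - q) (enum T)) pairwise_cat => /andP[/allrelP lt _].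
rewrite !inE => iq jq; apply: lt => //.
have : i \in enum T by rewrite mem_enum.
by rewrite -{1}(cat_take_drop (#|T| - q) (enum T)) mem_cat (negPf iq) orbF.
Qed.

Lemma largest_full T : largest T #|T| = T.
Proof. by apply/setP=> i; rewrite inE subnn drop0 mem_enum. Qed.

Lemma largestS T q : (q < #|T|)%N ->
  exists2 t, t \in T :\: largest T q & largest T q.+1 = t |: largest T q.
Proof.
move=> qT; have /card_gt0P[i0 _] : (0 < #|T|)%N by apply: leq_ltn_trans qT.
have lt : (#|T| - q.+1 < size (enum T))%N by rewrite -cardE ltn_subrL /= (leq_ltn_trans _ qT).
exists (nth i0 (enum T) (#|T| - q.+1)); last first.
  by apply/setP=> i; rewrite !inE (drop_nth i0) // inE -subSn // subSS.
rewrite !inE -(mem_enum T) mem_nth // andbT.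
have := enum_uniq T; rewrite -{1}(cat_take_drop (#|T| - q.+1) (enum T)) cat_uniq.
by rewrite (drop_nth i0) // -subSn // subSS => /and3P[_ _ /andP[]].
Qed.

Hypothesis simpleM : simple_matroid M.

Lemma zXE T q : zX M T q = cl M (largest T q).
Proof.
case: q => //=; rewrite /largest subn0 drop_oversize ?cardE //.
by rewrite -(simple_cl0 simpleM); congr (cl M _); apply/setP=> i; rewrite !inE.
Qed.

Lemma sub_zX T : T \subset zX M T #|T|.
Proof. by rewrite zXE largest_full sub_cl. Qed.

(** The remaining elements of [T] lie below all of [largest T q], so [nbc_cl_lt] keeps them out of
    its closure. *)
Lemma setI_zX T q : nbc M T -> T :&: zX M T q = largest T q.
Proof.
move=> nT; apply/setP=> i; rewrite inE zXE; apply/andP/idP=> [[iT]|iq].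
  apply: contraTT => iq; apply: nbc_cl_lt (largest_sub T q) _ => // j.
  exact: largest_lt.
by rewrite (subsetP (largest_sub T q)) // (subsetP (sub_cl _ _)).
Qed.

Lemma zX_S T q : zX M T q.+1 = zX M T q :|: zS M T q.+1.
Proof. by rewrite -{1}(setIidPr (zXS M T (leqnSn q))) setID. Qed.

Lemma zS_sub T q m : (q <= m)%N -> zS M T q \subset zX M T m.
Proof. by move=> qm; apply: subset_trans (subsetDl _ _) (zXS M T qm). Qed.

Lemma zX_zS_disjoint T q : [disjoint zX M T q & zS M T q.+1].
Proof. exact: disjoint_setDr. Qed.

(** Here [t] is the element that [largest T q.+1] adds. A smaller element of the flat would lie
    below all of [largest T q.+1], against [nbc_cl_lt]. *)
Lemma setI_zS T q : nbc M T -> (q < #|T|)%N ->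
  exists2 t, T :&: zS M T q.+1 = [set t] &
    forall x, x \in zX M T q.+1 -> (t <= x)%N.
Proof.
move=> nT qT; have [t] := largestS qT; rewrite inE => /andP[tq tT] eL.
exists t.
  apply/setP=> i; have /setP/(_ i) := setI_zX q nT; have /setP/(_ i) := setI_zX q.+1 nT.
  rewrite eL !in_setI in_setD in_setU1 in_set1.
  have [->|_] := eqVneq i t; first by rewrite (negPf tq) tT /= => -> ->.
  by case: (i \in T) => //= -> ->; rewrite andNb.
move=> x; rewrite zXE leqNgt; apply: contraL => xt.
apply: (nbc_cl_lt nT (largest_sub _ _)) => i; rewrite eL => /setU1P[->//|iq].
exact: ltn_trans xt (largest_lt tT tq iq).
Qed.

(* S is such a transversal iff e_(~: S) occurs in z T. *)
Definition zS_transversal T S : bool :=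
  (S \subset zX M T #|T|) && all (fun q => #|zS M T q :&: S| == 1)%N (iota 1 #|T|).

Lemma zS_transversal_card1 T S q : zS_transversal T S -> (q < #|T|)%N ->
  #|zS M T q.+1 :&: S| = 1%N.
Proof. by case/andP=> _ /allP h qT; apply/eqP/h; rewrite mem_iota. Qed.

Lemma card_zS_transversal T S : zS_transversal T S -> #|S| = #|T|.
Proof.
move=> tS; suff h m : (m <= #|T|)%N -> #|S :&: zX M T m| = m.
  by rewrite -[RHS]h // (setIidPl _) //; case/andP: tS.
elim: m => [|m IH] mT; first by rewrite /= setI0 cards0.
rewrite zX_S setIUr cardsU IH ?(ltnW mT) // (setIC S (zS _ _ _)) zS_transversal_card1 //.
suff /eqP-> : (S :&: zX M T m) :&: (zS M T m.+1 :&: S) == set0.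
  by rewrite cards0 subn0 addn1.
rewrite setI_eq0; apply: disjointWl (subsetIr _ _) _.
by apply: disjointWr (subsetIl _ _) _; apply: zX_zS_disjoint.
Qed.

(** Each new block adds at most one element, which lies outside the preceding flat, so
    [indep_setU1_cl] applies. *)
Lemma indep_setI_zX T S : (forall q, (q < #|T|)%N -> (#|zS M T q.+1 :&: S| <= 1)%N) ->
  forall m, (m <= #|T|)%N -> S :&: zX M T m \in indep M.
Proof.
move=> le1; elim=> [|m IH] mT; first by rewrite /= setI0 indep0.
have {IH} iS := IH (ltnW mT).
rewrite zX_S setIUr (setIC S (zS _ _ _)).
have := le1 m mT; rewrite leq_eqVlt ltnS leqn0 => /orP[/cards1P[x ex]|]; last first.
  by rewrite cards_eq0 => /eqP->; rewrite setU0.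
rewrite ex setUC; apply: (@indep_setU1_cl _ _ (largest T m)) => //; rewrite -zXE ?subsetIr //.
have : x \in zS M T m.+1 :&: S by rewrite ex set11.
by rewrite !inE => /andP[/andP[]].
Qed.

Lemma zS_transversal_self T : nbc M T -> zS_transversal T T.
Proof.
move=> nT; rewrite /zS_transversal sub_zX; apply/allP=> -[|q]; rewrite mem_iota // add1n ltnS.
by case/andP=> _ /(setI_zS nT)[t e _]; rewrite setIC e cards1.
Qed.

(* An nbc set is the least of its transversals, since it meets each block in
   the minimum of the flat. *)
Lemma zS_transversal_sum T S : nbc M T -> zS_transversal T S ->
  (* Strictness comes from carrying the equality case through the induction on flats. *)
  S != T -> (\sum_(i in T) i < \sum_(i in S) i)%N.
Proof.
move=> nT tS; suff h m : (m <= #|T|)%N ->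
  (\sum_(i in T :&: zX M T m) i <= \sum_(i in S :&: zX M T m) i)%N /\
  (\sum_(i in T :&: zX M T m) i = \sum_(i in S :&: zX M T m) i -> T :&: zX M T m = S :&: zX M T m).
  have [] := h #|T| (leqnn _); case/andP: tS => /setIidPl-> _; rewrite (setIidPl (sub_zX T)).
  rewrite leq_eqVlt => /orP[/eqP e|//]; by move=> /(_ e) ->; rewrite eqxx.
elim: m => [|m IH] mT; first by rewrite /= !setI0.
have [le eqs] := IH (ltnW mT).
have [t et mint] := setI_zS nT mT.
have /eqP/cards1P[s] := zS_transversal_card1 tS mT; rewrite setIC => es.
have ts : (t <= s)%N.
  apply: mint; have : s \in S :&: zS M T m.+1 by rewrite es set11.
  by rewrite !inE => /and3P[].
have dis A B : [disjoint A :&: zX M T m & B :&: zS M T m.+1].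
  apply: disjointWl (subsetIr _ _) _; apply: disjointWr (subsetIr _ _) _.
  exact: zX_zS_disjoint.
rewrite zX_S !(setIUr _ (zX _ _ _)) !sum_setU // et es !big_set1; split; first exact: leq_add.
move=> e; have e1 : \sum_(i in T :&: zX M T m) i = \sum_(i in S :&: zX M T m) i.
  apply/eqP; rewrite eqn_leq le /= -(leq_add2r t) e; exact: leq_add.
by rewrite (eqs e1); move: e; rewrite e1 => /addnI /val_inj ->.
Qed.

End NbcSets.

(** * The annihilator of the Orlik-Solomon ideal and the elements z(T) *)

Section Annihilator.
Local Open Scope ring_scope.
Variables (R : comNzRingType) (n : nat) (M : matroid 'I_n).
Local Notation E := (exterior R n).
Implicit Types (a b : E) (A B C S T U V : {set 'I_n}).

Lemma ext_scaleE k a U : (k *: a) U = k * a U.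
Proof. by rewrite ffunE. Qed.

Lemma homogeneous_bd_basis_vec S : homogeneous #|S|.-1 (bd (basis_vec R S)).
Proof.
move=> U; apply: contraNeq => /eqP nz; apply: contraT => nU; case: nz.
apply: (signed_indicator0 (bd_basis_vec_signed R S)); apply: contra nU.
by case/andP=> US /eqP cU; rewrite -(cardsID U S) (setIidPr US) cU addn1.
Qed.

Lemma annihilator_OS_ideal_gen a :
  (forall S, dependent M S -> a * bd (basis_vec R S) = 0) ->
  annihilator (OS_ideal R M) a.
Proof.
(* The middle factor [c] makes [J] stable under left multiplication; on generators, graded
   commutativity moves it to the right. *)
move=> a0 b; pose J b := forall c, a * c * b = 0.
suff h : OS_ideal R M b -> J b by move/h/(_ 1); rewrite mulr1.
apply; first split=> [c|x y hx hy c|x y hy c|x y hy c].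
- by rewrite mulr0.
- by rewrite mulrDr hx hy addr0.
- by rewrite mulrA -(mulrA a) hy.
- by rewrite mulrA hy mul0r.
move=> _ [S dS ->] c; rewrite e_setE (ext_basisE c) mulr_sumr mulr_suml big1 // => V _.
rewrite -scalerAr -scalerAl -mulrA.
rewrite (ext_mulC (@homogeneous_basis_vec R n V) (@homogeneous_bd_basis_vec S)).
by rewrite -scalerAr mulrA a0 // mul0r !scaler0.
Qed.

Lemma annihilator_OS_ideal_mul a S b : annihilator (OS_ideal R M) a ->
  dependent M S -> a * (bd (basis_vec R S) * b) = 0.
Proof.
move=> ha dS; apply: ha => J [_ _ _ Jr] gJ; apply: Jr; apply: gJ.
by exists S; rewrite ?e_setE.
Qed.

(** Taking the top coefficient pairs complementary degrees, turning relations modulo the ideal into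
    relations between coefficients of [a]. *)
Lemma mul_basis_vec_setT a S :
  (a * basis_vec R S) setT = (-1) ^+ inversions (~: S) S * a (~: S).
Proof. by rewrite mul_basis_vecE subsetT setTD. Qed.

Lemma sign_mul_eq0 k (x : R) : (-1) ^+ k * x = 0 -> x = 0.
Proof. by move/(congr1 (fun y => (-1) ^+ k * y)); rewrite mulr0 mulrA sign_sqr mul1r. Qed.

(* A non-nbc set S contains C :\ x for a circuit C with minimum x; multiplying
   bd e_C by e_(S :\: C) writes e_S modulo the ideal as a signed sum of monomials
   in which some element of S is replaced by the smaller x. *)
Lemma annihilator_nbc_eq0 p a : (p <= n)%N ->
  annihilator (OS_ideal R M) a -> homogeneous (n - p) a ->
  (forall T, T \in nbc_sets M p -> a (~: T) = 0) -> a = 0.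
Proof.
move=> pn Ia ha a0; suff h S : #|S| = p -> a (~: S) = 0.
  apply/ffunP=> U; rewrite [RHS]ffunE; have [eU|/ha//] := eqVneq #|U| (n - p)%N.
  by rewrite -(setCK U) h // cardsCs setCK card_ord eU subKn.
move: {2}(\sum_(i in S) i).+1%N (ltnSn (\sum_(i in S) i)) => k.
elim: k S => // k IH S; rewrite ltnS => Sk cS.
have [nS|] := boolP (nbc M S); first by apply: a0; rewrite inE nS cS eqxx.
case/non_nbc_exchange=> C [x [cC xC minx BS]]; set B := C :\ x in BS minx.
have dis : [disjoint B & S :\: B] by apply: disjoint_setDr.
have BSD : B :|: S :\: B = S by rewrite -{1}(setIidPr BS) setID.
(* In the top coefficient of this vanishing product, the term [V = B] is [a (~: S)] up to sign; all
   other terms will vanish by induction. *)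
have /(congr1 (fun b : E => b setT)) :=
  annihilator_OS_ideal_mul (basis_vec R (S :\: B)) Ia (minsetp cC).
rewrite (ext_basisE (bd _)) mulr_suml mulr_sumr sum_ffunE [RHS]ffunE (bigD1 B) //=.
rewrite big1 => [|V VB].
  rewrite -scalerAl -scalerAr basis_vec_mul dis BSD -scalerAr !ext_scaleE.
  have := bd_basis_vec_signed R C B; rewrite subsetDl setDDr setDv set0U.
  rewrite (setIidPr _) ?sub1set // cards1 eqxx => -[l ->].
  by rewrite addr0 mul_basis_vec_setT => /sign_mul_eq0/sign_mul_eq0/sign_mul_eq0.
rewrite -scalerAl -scalerAr ext_scaleE.
have := bd_basis_vec_signed R C V; case: ifP => [/andP[VC]|_ ->]; last by rewrite mul0r.
case/cards1P=> y ey _; rewrite basis_vec_mul; case: ifP => dV; last by rewrite mulr0 [X in _ * X]ffunE mulr0.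
(* Here [V] is [C] without some [y] of [B], so [V :|: S :\: B] is [S] with [y] replaced by the
   smaller [x]. *)
rewrite -scalerAr ext_scaleE mul_basis_vec_setT IH ?mulr0 //.
  have [yC yV] : y \in C /\ y \notin V.
    by apply/andP; rewrite andbC -in_setD ey set11.
  have VE : C = y |: V by rewrite setUC -ey -{1}(setIidPr VC) setID.
  have yB : y \in B.
    rewrite !inE yC andbT; apply: contraNneq VB => yx.
    by apply/eqP/setP=> i; rewrite /B VE -yx !inE; case: eqP => // ->; rewrite (negPf yV).
  have : (\sum_(i in C) i = x + \sum_(i in B) i)%N.
    by rewrite (big_setD1 x).
  rewrite {1}VE big_setU1 //= => eC; apply: leq_trans Sk.
  have -> : (\sum_(i in S) i = \sum_(i in B) i + \sum_(i in S :\: B) i)%N.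
    by rewrite -sum_setU ?BSD.
  rewrite sum_setU // ltn_add2r -(ltn_add2l x) -eC ltn_add2r.
  exact: minx.
have cVB : #|V| = #|B|.
  have := cardsID V C; rewrite (setIidPr VC) ey cards1 (cardsD1 x C) xC addn1.
  by case.
by rewrite -cS -{2}BSD !cardsU (disjoint_setI0 dis) (disjoint_setI0 dV) cVB.
Qed.

Definition zprod T m : E := \prod_(1 <= q < m.+1) bd (e_set R (zS M T q)).

Lemma zprodS T m : zprod T m.+1 = zprod T m * bd (basis_vec R (zS M T m.+1)).
Proof. by rewrite /zprod big_nat_recr //= e_setE. Qed.

(** The degree only determines a sign in [bd_leibniz], so it stays existential. *)
Lemma homogeneous_zprod T m : exists d, homogeneous d (zprod T m).
Proof.
elim: m => [|m [d hd]]; first by exists #|(set0 : {set 'I_n})|;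
  rewrite /zprod big_geq // ext_oneE; apply: homogeneous_basis_vec.
exists (d + #|zS M T m.+1|.-1)%N; rewrite zprodS; apply: homogeneous_mul hd _.
exact: homogeneous_bd_basis_vec.
Qed.

Lemma bd_one : bd (1 : E) = 0.
Proof.
apply/ffunP=> U; rewrite ext_oneE [RHS]ffunE.
apply: (signed_indicator0 (bd_basis_vec_signed R _)).
by rewrite set0D cards0 andbF.
Qed.

(** By the Leibniz rule, since every factor is itself a boundary. *)
Lemma bd_zprod T m : bd (zprod T m) = 0.
Proof.
elim: m => [|m IH]; first by rewrite /zprod big_geq // bd_one.
have [d hd] := homogeneous_zprod T m.
by rewrite zprodS (bd_leibniz _ hd) IH bd_basis_vec_bd mul0r mulr0 scaler0 addr0.
Qed.

Lemma setDI_sub A B C : A \subset C -> A :\: (B :&: C) = A :\: B.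
Proof. by rewrite -setD_eq0 setDIr => /eqP->; rewrite setU0. Qed.

Lemma zprod_signed T m : signed_indicator (zprod T m)
  (fun U => (U \subset zX M T m) && all (fun q => #|zS M T q :\: U| == 1)%N (iota 1 m)).
Proof.
elim: m => [|m IH].
  rewrite /zprod big_geq // ext_oneE.
  apply: signed_indicator_eq (@basis_vec_signed R n set0) => U.
  by rewrite /= subset0 andbT.
rewrite zprodS; apply: signed_indicator_eq (signed_indicator_mul
  (zX_zS_disjoint M T m) IH _ (@bd_basis_vec_signed R n _) _) => U; last 1 first.
- by case/andP.
- rewrite -zX_S !subsetIr -(addn1 m) iotaD all_cat /= andbT add1n addn1.
  congr [&& _, _ & _]; last by rewrite setDIr setDv setU0.
  apply: eq_in_all => q; rewrite mem_iota add1n ltnS => /andP[_ qm].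
  have /setIidPl := zS_sub M T qm.
  rewrite setDIr => e; rewrite (_ : _ :\: zX M T m = set0) ?setU0 //.
  by apply/eqP; rewrite setD_eq0 zS_sub.
by case/andP.
Qed.

Lemma zE T : exists k : nat,
  z R M T = (-1) ^+ k *: (zprod T #|T| * basis_vec R (~: zX M T #|T|)).
Proof. by exists (perm_of_seq (zlisting M T)); rewrite /z -e_setE. Qed.

(** The last factor forces [U] to contain [~: zX M T #|T|], and each boundary factor makes [U] miss
    exactly one element of its block. *)
Lemma z_signed T : signed_indicator (z R M T) (fun U => zS_transversal M T (~: U)).
Proof.
have [k ->] := zE T; apply: signed_indicator_scale.
have dis : [disjoint zX M T #|T| & ~: zX M T #|T|] by rewrite -setI_eq0 setICr.
apply: signed_indicator_eq (signed_indicator_mul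
  dis (zprod_signed T #|T|) _ (@basis_vec_signed R n _) _) => U; last 1 first.
- by move/eqP->.
- rewrite setUCr subsetT subsetIr /= andbC; congr (_ && _).
    by rewrite (sameP eqP setIidPr) -setCS setCK.
  apply: eq_in_all => q; rewrite mem_iota add1n ltnS => /andP[_ qm].
  by rewrite setDI_sub ?zS_sub // setDE.
by case/andP.
Qed.

Hypothesis simpleM : simple_matroid M.

(** A nonzero coefficient at [U] requires [U :\: S] to miss just one element of each block. Then [S]
    meets each block at most once and is independent. *)
Lemma zprod_mul_dependent T S : dependent M S -> S \subset zX M T #|T| ->
  zprod T #|T| * basis_vec R S = 0.
Proof.
move=> dS SX; apply/ffunP=> U; rewrite mul_basis_vecE [RHS]ffunE.
case: ifP => // SU; rewrite (signed_indicator0 (zprod_signed T #|T|)) ?mulr0 //.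
apply: contra dS => /andP[_ /allP h].
rewrite -(setIidPl SX); apply: (indep_setI_zX simpleM) => // q qT.
have : (q.+1 \in iota 1 #|T|) by rewrite mem_iota.
move/h/eqP <-; apply: subset_leq_card; apply/subsetP=> i; rewrite !inE.
by case/andP=> -> iS; rewrite iS.
Qed.

Lemma z_annihilator T : annihilator (OS_ideal R M) (z R M T).
Proof.
apply: annihilator_OS_ideal_gen => S dS; have [k ->] := zE T.
rewrite -scalerAl -mulrA; set X := zX M T #|T|; set Q := zprod _ _.
suff -> : Q * (basis_vec R (~: X) * bd (basis_vec R S)) = 0 by rewrite scaler0.
(* If [S :&: X] is dependent, [Q] kills its monomial and, because bd Q = 0, the boundary of that
   monomial. Leibniz for e_(S :&: X) e_(S :\: X) then gives Q bd e_S = 0. *)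
have [dSX|iSX] := boolP (S :&: X \notin indep M).
  have QS : Q * basis_vec R (S :&: X) = 0 by apply: zprod_mul_dependent; rewrite ?subsetIr.
  have QbdS : Q * bd (basis_vec R (S :&: X)) = 0.
    have [d hd] := homogeneous_zprod T #|T|.
    move: (bd_leibniz (basis_vec R (S :&: X)) hd).
    rewrite -/Q QS bd_zprod mul0r add0r linear0 => /(congr1 (fun a => (-1) ^+ d *: a)).
    by rewrite scaler0 scalerA sign_sqr scale1r.
  rewrite (ext_mulC (@homogeneous_basis_vec R n _) (@homogeneous_bd_basis_vec S)).
  rewrite -scalerAr mulrA (_ : Q * _ = 0) ?mul0r ?scaler0 //.
  have dis : [disjoint S :&: X & S :\: X].
    by apply: disjointWl (subsetIr _ _) _; apply: disjoint_setDr.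
  have := basis_vec_mul R (S :&: X) (S :\: X); rewrite dis setID.
  move/(congr1 (fun a => Q * bd a)).
  rewrite (bd_leibniz _ (@homogeneous_basis_vec R n _)) mulrDr -scalerAr !mulrA QbdS QS.
  rewrite !mul0r scaler0 addr0 linearZ /= -scalerAr.
  move/(congr1 (fun a => (-1) ^+ inversions (S :&: X) (S :\: X) *: a)).
  by rewrite scaler0 scalerA sign_sqr scale1r.
(* If [S :&: X] is independent, a term [V] of bd e_S surviving the product lies in [X]. Adding back
   the deleted [x], inside or outside the flat [X], would make [S] independent. *)
suff -> : basis_vec R (~: X) * bd (basis_vec R S) = 0 by rewrite mulr0.
rewrite (ext_basisE (bd _)) mulr_sumr big1 // => V _; rewrite -scalerAr basis_vec_mul.
case: ifP => dV; last by rewrite scaler0.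
rewrite (signed_indicator0 (bd_basis_vec_signed R S)) ?scale0r //.
apply: contra dS => /andP[VS /cards1P[x ex]].
have VX : V \subset X by rewrite -[V]setCK disjoints_subset setCS in dV *.
have SE : S = x |: V by rewrite setUC -ex -{1}(setIidPr VS) setID.
have [xX|xX] := boolP (x \in X).
  have SX : S \subset X by rewrite SE subUset sub1set xX.
  by rewrite negbK (setIidPl SX) in iSX.
rewrite SE; apply: (@indep_setU1_cl _ M (largest T #|T|)); rewrite -?zXE //.
by apply: indepS (negbNE iSX); rewrite subsetI VS.
Qed.

Lemma z_homogeneous T : homogeneous (n - #|T|) (z R M T).
Proof.
move=> U; apply: contraNeq => /eqP nz; apply: contraT => nU; case: nz.
apply: (signed_indicator0 (z_signed T)); apply: contra nU => tU.
by rewrite -(card_zS_transversal tU) cardsCs card_ord.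
Qed.

End Annihilator.

Theorem proposition3p8 (R : comNzRingType) (n l : nat) (M : matroid 'I_n)
    (simpleM : simple_matroid M) (rankM : rank M = l)
    (p : nat) (p_range : (1 <= p <= l)%N) :
  is_basis_of (nbc_sets M p) (z R M)
    (fun a : exterior R n =>
       annihilator (OS_ideal R M) a /\ homogeneous (n - p) a).
Proof.
pose m (T S : {set 'I_n}) := z R M T (~: S).
have nbcP (T : {set 'I_n}) : T \in nbc_sets M p -> nbc M T /\ #|T| = p.
  by rewrite inE => /andP[nT /eqP cT].
have m_diag T : T \in nbc_sets M p -> (m T T * m T T = 1)%R.
  case/nbcP=> nT _; have := z_signed R M T (~: T).
  by rewrite setCK zS_transversal_self // /m => -[k ->]; apply: sign_sqr.
have m_trig T S : T \in nbc_sets M p -> S \in nbc_sets M p -> T != S ->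
    \sum_(i in S) i <= \sum_(i in T) i -> m T S = 0%R.
  case/nbcP=> nT _ _ TS le; apply: (signed_indicator0 (z_signed R M T)).
  rewrite setCK; apply: contraL le => tS; rewrite -ltnNge.
  by apply: zS_transversal_sum tS _; rewrite // eq_sym.
have sumE (c : {set 'I_n} -> R) S : ((\sum_(T in nbc_sets M p) c T *: z R M T) (~: S) =
    \sum_(T in nbc_sets M p) c T * m T S)%R.
  by rewrite sum_ffunE; apply: eq_bigr => T _; rewrite ext_scaleE.
have pn : p <= n.
  case/andP: p_range => _ /leq_trans-> //; rewrite -rankM /rank.
  by have [B _ [_ <-]] := rk_ex M setT; have := max_card (mem B); rewrite card_ord.
have zN T : T \in nbc_sets M p ->
    annihilator (OS_ideal R M) (z R M T) /\ homogeneous (n - p) (z R M T).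
  by case/nbcP=> _ <-; split; [apply: z_annihilator | apply: z_homogeneous].
split=> // [c c0 | x [Ix hx]].
  apply: (triangular_inj m_diag m_trig) => S _.
  by rewrite -sumE c0 ffunE.
(* Match the coefficients of [x] at complements of nbc sets; the difference lies in the same
   component of the annihilator and vanishes there, so it is zero. *)
have [c hc] := triangular_surj m_diag m_trig (fun S => x (~: S)).
exists c; apply/eqP; rewrite -subr_eq0; apply/eqP.
apply: (annihilator_nbc_eq0 (M := M) pn).
- move=> b Ib; rewrite mulrBl Ix // mulr_suml big1 ?subrr // => T /zN[Iz _].
  by rewrite -scalerAl Iz // scaler0.
- move=> U nU; rewrite !ffunE hx // sum_ffunE big1 ?subrr // => T /zN[_ hz].
  by rewrite ext_scaleE hz // mulr0.
- move=> S nS; rewrite !ffunE.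
  by have := hc S nS; rewrite -sumE => ->; rewrite subrr.
Qed.
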